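(* Let $X$ be a topological space. Then the collection ${}^{*}O(X)$ of all $*$-open subsets of $X$ is a topology on $X$.
   Context: For a topological space $X$, a set $U\subseteq X$ is called regular open if $\mathrm{int}(\mathrm{cl}(U))=U$; the collection of all regular open subsets of $X$ is denoted $R.O(X)$. A set $A\subseteq X$ is called $*$-open if for every $x\in A$ there exists $U\in R.O(X)$ with $x\in U\subseteq A$. The collection of all $*$-open subsets of $X$ is denoted ${}^{*}O(X)$. *)

(* Defs.v *)
From mathcomp Require Import all_boot.
From mathcomp Require Import boolp classical_sets topology.

Set Implicit Arguments.
Unset Strict Implicit.
Unset Printing Implicit Defensive.

Local Open Scope classical_set_scope.

Definition regular_opens (X : topologicalType) : set (set X) :=
  [set U | regopen U].

Definition star_open (X : topologicalType) (A : set X) : Prop :=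
  forall x, A x -> exists U, [/\ regular_opens U, U x & U `<=` A].

Definition star_opens (X : topologicalType) : set (set X) :=
  [set A | star_open A].

(* Arbitrary unions are taken over subfamilies F of O, indexed by themselves. *)
Record is_topology (T : Type) (O : set (set T)) : Prop := IsTopology {
  is_topology0 : O set0;
  is_topologyT : O setT;
  is_topologyI : forall A B : set T, O A -> O B -> O (A `&` B);
  is_topology_bigcup :
    forall F : set (set T), F `<=` O -> O (\bigcup_(A in F) A)
}.

(* Main.v *)
Require Import Defs.
From mathcomp Require Import all_boot.
From mathcomp Require Import boolp classical_sets topology.

Local Open Scope classical_set_scope.

(** Regular open sets include the whole space ([regopenT]) and are stable under binary intersection
    ([regopenI]), so they form a base; star-open sets are the unions of its members. Unions need no
    further property of the base. *)

Lemma regopenT (X : topologicalType) : regopen [set: X].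
Proof. by rewrite /regopen closureT interiorT. Qed.

Lemma regopen_open (X : topologicalType) (U : set X) : regopen U -> open U.
Proof. by move=> <-; exact: open_interior. Qed.

(** Interior of closure is monotone and fixes [U] and [V], so it sends [U]&[V] into both. *)
Lemma regopenI (X : topologicalType) (U V : set X) :
  regopen U -> regopen V -> regopen (U `&` V).
Proof.
move=> rU rV; rewrite /regopen eqEsubset; split.
  rewrite -[in X in _ `<=` X]rU -[in X in _ `<=` X]rV subsetI.
  by split; apply/interiorS/closureS; [exact: subIsetl|exact: subIsetr].
(* An open set contained in its closure is contained in the interior of that closure. *)
rewrite -open_subsetE; first exact: subset_closure.
by apply: openI; exact: regopen_open.
Qed.

Theorem theorem16 (X : topologicalType) : is_topology (@star_opens X).
Proof.
split.
- by move=> x [].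
- by move=> x _; exists setT; split=> //; exact: regopenT.
- move=> A B oA oB x [/oA[U [rU Ux UA]] /oB[V [rV Vx VB]]].
  by exists (U `&` V); split=> //; [exact: regopenI|exact: setISS].
- move=> F FO x [A FA /(FO A FA)[U [rU Ux UA]]].
  by exists U; split=> // y /UA Ay; exists A.
Qed.
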